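(* Define integers $D'(n)$, $n\ge1$, by \[ \sum_{n=1}^\infty D'(n) q^n := \sum_{n=1}^\infty q^{2n}(q^{n+1};q)_\infty^3 (q^{n};q)_{n}. \] Then \[ \sum_{n=1}^\infty D'(n) q^{8n+2} = 2 \sum_{r,n=0}^\infty (-1)^{n} q^{(2r+1)^2 + (2r+1+2n)^2} - \sum_{n=0}^\infty (-1)^{n}(n+1) q^{1+(2n+1)^2} - \sum_{n=0}^\infty q^{2(2n+1)^2}. \]
   Context: Here $q$ is a complex number with $|q|<1$ (equivalently, identities of formal power series in $q$). Notation: $(a;q)_0=1$, $(a;q)_n=\prod_{j=0}^{n-1}(1-aq^j)$, $(a;q)_\infty=\prod_{j=0}^{\infty}(1-aq^j)$, and $(a;q)_\infty^k$ denotes the $k$-th power of $(a;q)_\infty$. *)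

(* Defs.v *)
From HB Require Import structures.
From mathcomp Require Import all_boot all_order all_algebra.
From mathcomp Require Import finmap.
From mathcomp Require Import boolp classical_sets functions cardinality fsbigop.

Set Implicit Arguments.
Unset Strict Implicit.
Unset Printing Implicit Defensive.
Import GRing.Theory.
Local Open Scope classical_set_scope.
Local Open Scope ring_scope.

(* Formal power series, as coefficient sequences. *)
Record fps (R : Type) := Fps { fpscoef : nat -> R }.

Section FpsRing.
Variable R : comNzRingType.
Implicit Types F G H : fps R.

Lemma fpsP F G : fpscoef F =1 fpscoef G <-> F = G.
Proof. by split=> [|->//]; case: F G => [f] [g] /= /funext ->. Qed.

HB.instance Definition _ := gen_eqMixin (fps R).
HB.instance Definition _ := gen_choiceMixin (fps R).

Definition fps0 : fps R := Fps (fun=> 0).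
Definition fps1 : fps R := Fps (fun m => (m == 0)%:R).
Definition fpsadd F G := Fps (fun m => fpscoef F m + fpscoef G m).
Definition fpsopp F := Fps (fun m => - fpscoef F m).
Definition fpsmul F G :=
  Fps (fun m => \sum_(i < m.+1) fpscoef F i * fpscoef G (m - i)).

Fact fpsaddA : associative fpsadd.
Proof. by move=> F G H; apply/fpsP => m /=; rewrite addrA. Qed.
Fact fpsaddC : commutative fpsadd.
Proof. by move=> F G; apply/fpsP => m /=; rewrite addrC. Qed.
Fact fpsadd0 : left_id fps0 fpsadd.
Proof. by move=> F; apply/fpsP => m /=; rewrite add0r. Qed.
Fact fpsaddN : left_inverse fps0 fpsopp fpsadd.
Proof. by move=> F; apply/fpsP => m /=; rewrite addNr. Qed.

HB.instance Definition _ :=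
  GRing.isZmodule.Build (fps R) fpsaddA fpsaddC fpsadd0 fpsaddN.

Fact fpsmulC : commutative fpsmul.
Proof.
move=> F G; apply/fpsP => m /=; rewrite (reindex_inj rev_ord_inj) /=.
by apply: eq_bigr => i _; rewrite subSS subKn -1?ltnS // mulrC.
Qed.

Let trunc N F : {poly R} := \poly_(i < N) fpscoef F i.

Let fpsmul_trunc N F G m : (m < N)%N ->
  fpscoef (fpsmul F G) m = (trunc N F * trunc N G)`_m.
Proof.
move=> mN; rewrite coefM; apply: eq_bigr => -[i /= im] _.
rewrite !coef_poly (leq_ltn_trans (leq_subr _ _) mN).
by rewrite (leq_trans im mN).
Qed.

Fact fpsmulA : associative fpsmul.
Proof.
move=> F G H; apply/fpsP => m.
have E (A B C : fps R) : fpscoef (fpsmul A (fpsmul B C)) m =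
    (trunc m.+1 A * (trunc m.+1 B * trunc m.+1 C))`_m.
  rewrite coefM; apply: eq_bigr => i _.
  by rewrite coef_poly ltn_ord (@fpsmul_trunc m.+1) // ltnS leq_subr.
by rewrite E (fpsmulC (fpsmul F G)) E mulrA mulrC mulrCA mulrA mulrC mulrA.
Qed.

Fact fpsmul1 : left_id fps1 fpsmul.
Proof.
move=> F; apply/fpsP => m /=; rewrite big_ord_recl /= mul1r subn0.
by rewrite big1 ?addr0 // => i _; rewrite mul0r.
Qed.

Fact fpsmulDl : left_distributive fpsmul fpsadd.
Proof.
move=> F G H; apply/fpsP => m /=; rewrite -big_split /=.
by apply: eq_bigr => i _; rewrite mulrDl.
Qed.

Fact fps1_neq0 : fps1 != 0.
Proof.
by apply/eqP => /fpsP/(_ 0) /= /eqP; rewrite oner_eq0.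
Qed.

HB.instance Definition _ := GRing.Zmodule_isComNzRing.Build (fps R)
  fpsmulA fpsmulC fpsmul1 fpsmulDl fps1_neq0.

Definition fpsX : fps R := Fps (fun m => (m == 1)%:R).

Lemma fpscoefD F G m : fpscoef (F + G) m = fpscoef F m + fpscoef G m.
Proof. by []. Qed.
Lemma fpscoefN F m : fpscoef (- F) m = - fpscoef F m.
Proof. by []. Qed.
Lemma fpscoefM F G m :
  fpscoef (F * G) m = \sum_(i < m.+1) fpscoef F i * fpscoef G (m - i).
Proof. by []. Qed.
Lemma fpscoef1 m : fpscoef (1 : fps R) m = (m == 0)%:R.
Proof. by []. Qed.
Lemma fpscoef_int (z : int) m :
  fpscoef (z%:~R : fps R) m = if m == 0 then z%:~R else 0.
Proof.
have E n : fpscoef (n%:R : fps R) m = if m == 0 then n%:R else 0.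
  elim: n => [|n IH]; first by rewrite mulr0n; case: ifP.
  rewrite mulrS fpscoefD IH fpscoef1.
  by case: m {IH} => [|m] /=; rewrite ?mulrS ?addr0.
case: z => n; first exact: E.
by rewrite NegzE !mulrNz fpscoefN E; case: eqP; rewrite ?oppr0.
Qed.

Lemma fpscoefXM F m :
  fpscoef (fpsX * F) m = if m is m'.+1 then fpscoef F m' else 0.
Proof.
case: m => [|m]; first by rewrite fpscoefM big_ord1 /= mul0r.
rewrite fpscoefM big_ord_recl /= mul0r add0r big_ord_recl /= mul1r.
rewrite subSS subn0 big1 ?addr0 // => i _.
by rewrite mul0r.
Qed.

Lemma fpscoefXnM n F m :
  fpscoef (fpsX ^+ n * F) m = if (m < n)%N then 0 else fpscoef F (m - n).
Proof.
elim: n F m => [|n IH] F m; first by rewrite mul1r subn0.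
rewrite exprSr -mulrA IH fpscoefXM ltnS; case: ltngtP => //.
  by move=> nm; rewrite -subnSK.
by move=> ->; rewrite subnn.
Qed.

(* Convergence for the X-adic topology. *)
Definition fps_cvg (u : nat -> fps R) F :=
  forall m, exists K, forall k, (K <= k)%N -> fpscoef (u k) m = fpscoef F m.

(* Meaningful only if u converges; 0 otherwise. *)
Definition fps_lim (u : nat -> fps R) : fps R := xget 0 [set F | fps_cvg u F].

Lemma fps_cvg_unique u F G : fps_cvg u F -> fps_cvg u G -> F = G.
Proof.
move=> uF uG; apply/fpsP => m; have [K HK] := uF m; have [L HL] := uG m.
by rewrite -(HK (maxn K L)) ?leq_maxl // HL ?leq_maxr.
Qed.

Lemma fps_cvg_lim u F : fps_cvg u F -> fps_lim u = F.
Proof.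
move=> uF; rewrite /fps_lim; case: xgetP => [G _ uG|/(_ F)//].
exact: fps_cvg_unique uG uF.
Qed.

(* Summability of a family for the X-adic topology. *)
Definition fps_summable (I : choiceType) (A : set I) (f : I -> fps R) :=
  forall m, finite_set (A `&` (fun i => fpscoef (f i) m) @^-1` [set~ 0]).

(* Meaningful only if f is summable on A, as \sum_(i \in A) is a sum of finite
   support. *)
Definition fps_sum (I : choiceType) (A : set I) (f : I -> fps R) : fps R :=
  Fps (fun m => \sum_(i \in A) fpscoef (f i) m).

Lemma eq_fps_summable (I : choiceType) (A : set I) (f g : I -> fps R) :
  f =1 g -> fps_summable A f -> fps_summable A g.
Proof. by move=> /funext ->. Qed.

Lemma fps_summableXn (I : choiceType) (A : set I) (e : I -> nat)
    (f : I -> fps R) :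
  (forall m, finite_set (A `&` [set i | (e i <= m)%N])) ->
  fps_summable A (fun i => f i * fpsX ^+ e i).
Proof.
move=> fin m; apply: sub_finite_set (fin m) => i [Ai H]; split=> //.
rewrite /= leqNgt; apply/negP => lt; apply: H.
suff: fpscoef (f i * fpsX ^+ e i) m = 0 by [].
by rewrite mulrC fpscoefXnM lt.
Qed.

Lemma fps_summableXn_nat (A : set nat) (e : nat -> nat) (f : nat -> fps R) :
  (forall n, n <= e n)%N -> fps_summable A (fun n => f n * fpsX ^+ e n).
Proof.
move=> le; apply: fps_summableXn => m.
apply: sub_finite_set (finite_II m.+1) => n [_ /=].
by rewrite ltnS; apply: leq_trans (le n).
Qed.

End FpsRing.

Arguments fpsX {R}.

Notation "\fsum_ ( i 'in' A ) F" := (fps_sum A (fun i => F))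
  (at level 41, F at level 41, i, A at level 50,
   format "'[' \fsum_ ( i  'in'  A ) '/  '  F ']'") : ring_scope.

Notation "''q'" := (@fpsX int) : ring_scope.

(* The q-Pochhammer symbol (a;q)_n, where a may be any series in q. *)
Definition qpoch (a : fps int) (n : nat) : fps int :=
  \prod_(j < n) (1 - a * 'q ^+ j).

(* By qpoch_cvg, this limit exists for every a. *)
Definition qpochinf (a : fps int) : fps int := fps_lim (qpoch a).

Lemma qpochS a n : qpoch a n.+1 = qpoch a n * (1 - a * 'q ^+ n).
Proof. exact: big_ord_recr. Qed.

Lemma qpoch_cvg a : fps_cvg (qpoch a) (qpochinf a).
Proof.
pose F := Fps (fun m => fpscoef (qpoch a m.+1) m).
suff cF : fps_cvg (qpoch a) F by rewrite /qpochinf (fps_cvg_lim cF).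
move=> m; exists m.+1 => k; elim: k => // k IH.
rewrite leq_eqVlt => /predU1P[<- //|]; rewrite ltnS => mk; rewrite -IH //.
rewrite qpochS mulrBr mulr1 fpscoefD fpscoefN mulrA.
by rewrite [X in _ - fpscoef X _]mulrC fpscoefXnM mk subr0.
Qed.

Lemma fps_sum_coef (D : nat -> int) m :
  fpscoef (\fsum_(n in [set n | (0 < n)%N]) ((D n)%:~R * 'q ^+ n)) m =
  if (0 < m)%N then D m else 0.
Proof.
rewrite {1}/fps_sum [LHS]/fpscoef (eq_fsbigr (fun n => if n == m then D n else 0)); last first.
  move=> n _; rewrite mulrC fpscoefXnM fpscoef_int; case: ltngtP => // [nm|->].
    by rewrite subn_eq0 leqNgt nm.
  by rewrite subnn eqxx intz.
case: ltnP => [m0|]; last first.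
  rewrite leqn0 => /eqP->; apply: fsbig1 => n /=.
  by rewrite lt0n => /negbTE ->.
rewrite -(@fsbig_widen _ _ 0 +%R [set m]) ?fsbig_set1 ?eqxx // => [n ->//|n].
by case=> _ /= /eqP/negbTE ->.
Qed.

(* The defining series of the coefficients D' and every series of the identity
   they satisfy are summable, so no fps_sum takes its default value there; and
   exists_D' shows that D' exists. *)
Lemma summable_D' : fps_summable [set n | (0 < n)%N] (fun n =>
  'q ^+ (2 * n) * qpochinf ('q ^+ n.+1) ^+ 3 * qpoch ('q ^+ n) n).
Proof.
apply: (@eq_fps_summable _ _ _ (fun n =>
  qpochinf ('q ^+ n.+1) ^+ 3 * qpoch ('q ^+ n) n * 'q ^+ (2 * n))) => [n|].
  by rewrite mulrC mulrA.
by apply: fps_summableXn_nat => n; rewrite leq_pmull.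
Qed.

Lemma exists_D' : exists D : nat -> int,
  \fsum_(n in [set n | (0 < n)%N]) ((D n)%:~R * 'q ^+ n) =
  \fsum_(n in [set n | (0 < n)%N])
     ('q ^+ (2 * n) * qpochinf ('q ^+ n.+1) ^+ 3 * qpoch ('q ^+ n) n).
Proof.
pose S := \fsum_(n in [set n | (0 < n)%N])
  ('q ^+ (2 * n) * qpochinf ('q ^+ n.+1) ^+ 3 * qpoch ('q ^+ n) n).
exists (fpscoef S); apply/fpsP => m; rewrite fps_sum_coef.
case: m => // ; apply/esym/fsbig1 => n n0.
by rewrite -mulrA fpscoefXnM muln_gt0 (n0 : (0 < n)%N).
Qed.

Lemma summable_D'8 (D : nat -> int) : fps_summable [set n | (0 < n)%N]
  (fun n => (D n)%:~R * 'q ^+ (8 * n + 2)).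
Proof.
apply: fps_summableXn_nat => n.
by apply: leq_trans (leq_addr _ _); rewrite leq_pmull.
Qed.

Lemma summable_rhs1 : fps_summable [set: nat * nat] (fun rn =>
  (-1) ^+ rn.2 *
    'q ^+ ((2 * rn.1 + 1) ^ 2 + (2 * rn.1 + 1 + 2 * rn.2) ^ 2)).
Proof.
have sq k : (k <= k ^ 2)%N by case: k => // k; rewrite leq_pmulr.
apply: fps_summableXn => m.
apply: sub_finite_set (finite_setX (finite_II m.+1) (finite_II m.+1)).
move=> [r n] [_ /= le]; have {}le : (2 * r + 1 + 2 * n <= m)%N.
  by apply: leq_trans le; apply: leq_trans (sq _) (leq_addl _ _).
split=> /=; rewrite ltnS; apply: leq_trans le.
  by rewrite -addnA; apply: leq_trans (leq_addr _ _); rewrite leq_pmull.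
by apply: leq_trans (leq_addl _ _); rewrite leq_pmull.
Qed.

Lemma summable_rhs2 : fps_summable [set: nat] (fun n =>
  (-1) ^+ n * n.+1%:R * 'q ^+ (1 + (2 * n + 1) ^ 2)).
Proof.
apply: fps_summableXn_nat => n; apply: leq_trans (leq_addl _ _).
apply: (@leq_trans (2 * n + 1)).
  by apply: leq_trans (leq_addr _ _); rewrite leq_pmull.
by rewrite leq_pmulr // addn1.
Qed.

Lemma summable_rhs3 : fps_summable [set: nat] (fun n =>
  'q ^+ (2 * (2 * n + 1) ^ 2)).
Proof.
apply: (@eq_fps_summable _ _ _ (fun n =>
  1 * 'q ^+ (2 * (2 * n + 1) ^ 2))) => [n|]; first by rewrite mul1r.
apply: fps_summableXn_nat => n; apply: (@leq_trans ((2 * n + 1) ^ 2)).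
  apply: (@leq_trans (2 * n + 1)).
    by apply: leq_trans (leq_addr _ _); rewrite leq_pmull.
  by rewrite leq_pmulr // addn1.
by rewrite leq_pmull.
Qed.

(* Main.v *)
From HB Require Import structures.
Require Import Defs.
From mathcomp Require Import all_boot all_order all_algebra.
From mathcomp Require Import boolp classical_sets fsbigop.
From mathcomp Require Import ring.
Set Implicit Arguments.
Unset Strict Implicit.
Unset Printing Implicit Defensive.
Import GRing.Theory.
Local Open Scope classical_set_scope.
Local Open Scope ring_scope.

(* Write [p(a) = \sum_n (-a)^n q^(n(n-1)/2)]. Two identities on partial theta
   functions are used, with [b = c q]: Andrews and Warnaar's
     p(a) p(b) = \sum_n q^n (a b q^(n-1))_n (q^(n+1))_oo (a q^n)_oo (b q^n)_oo,
   and Warnaar's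
     p(a) + p(b) - 1 = \sum_n q^n (1 - a b / q) (a b q^n)_(n-1)
                               (q^(n+1))_oo (a q^n)_oo (b q^n)_oo.
   For the second, call W(a, b) the right-hand side: its mixed difference
   W(a, b) - W(a q, b) - W(a, b q) + W(a q, b q) telescopes to 0, so
   W(a, b) = W(a, 0) + W(0, b) - W(0, 0) as a q^N and b q^N tend to 0. The first
   follows, as both of its sides satisfy F(a, b) = W(a, b) + a b F(a q, b q).
   The generating series of D' is p(q)^2 minus the value at z = 1 of
   W(z, q) / (1 - z) = \sum_n (-1)^n q^(n(n+1)/2) (1 + z + ... + z^n), and
   expanding the square into pairs gives the theorem after the substitution
   q -> q^8 and a multiplication by q^2. *)

(** * Congruences modulo X^N, infinite products and weighted series *)

Section FormalSeries.
Variable R : comNzRingType.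
Implicit Types (F G H a b c : fps R) (f g : nat -> fps R).
Local Notation X := (@fpsX R).

Definition eqmodX N F G := forall m, (m < N)%N -> fpscoef F m = fpscoef G m.

Lemma eqmodX_eq F G : (forall N, eqmodX N F G) -> F = G.
Proof. by move=> FG; apply/fpsP => m; apply: (FG m.+1). Qed.

Lemma eqmodX_refl N F : eqmodX N F F.
Proof. by []. Qed.

Lemma eqmodX_sym N F G : eqmodX N F G -> eqmodX N G F.
Proof. by move=> FG m mN; rewrite FG. Qed.

Lemma eqmodX_trans N F G H : eqmodX N F G -> eqmodX N G H -> eqmodX N F H.
Proof. by move=> FG GH m mN; rewrite FG ?GH. Qed.

Lemma eqmodXD N F G F' G' :
  eqmodX N F F' -> eqmodX N G G' -> eqmodX N (F + G) (F' + G').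
Proof. by move=> FF GG m mN; rewrite !fpscoefD FF ?GG. Qed.

Lemma eqmodXN N F F' : eqmodX N F F' -> eqmodX N (- F) (- F').
Proof. by move=> FF m mN; rewrite !fpscoefN FF. Qed.

Lemma eqmodXB N F G F' G' :
  eqmodX N F F' -> eqmodX N G G' -> eqmodX N (F - G) (F' - G').
Proof. by move=> FF GG; apply/eqmodXD/eqmodXN. Qed.

Lemma eqmodXM N F G F' G' :
  eqmodX N F F' -> eqmodX N G G' -> eqmodX N (F * G) (F' * G').
Proof.
move=> FF GG m mN; rewrite !fpscoefM; apply: eq_bigr => i _.
rewrite FF ?GG //; first exact: leq_ltn_trans (leq_subr _ _) mN.
by apply: leq_trans mN; rewrite ltnS -ltnS.
Qed.

Lemma eqmodX_Xn M N F : (N <= M)%N -> eqmodX N (X ^+ M * F) 0.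
Proof. by move=> NM m mN; rewrite fpscoefXnM (leq_trans mN NM). Qed.

Lemma eqmodX_prod N n f g : (forall i, eqmodX N (f i) (g i)) ->
  eqmodX N (\prod_(i < n) f i) (\prod_(i < n) g i).
Proof.
move=> fg; elim: n => [|n IH]; first by rewrite !big_ord0.
by rewrite !big_ord_recr; apply: eqmodXM.
Qed.

Lemma eqmodX_sum N n f g : (forall i, eqmodX N (f i) (g i)) ->
  eqmodX N (\sum_(i < n) f i) (\sum_(i < n) g i).
Proof.
move=> fg; elim: n => [|n IH]; first by rewrite !big_ord0.
by rewrite !big_ord_recr; apply: eqmodXD.
Qed.

Lemma coef_sum n f m :
  fpscoef (\sum_(i < n) f i) m = \sum_(i < n) fpscoef (f i) m.
Proof.
elim: n => [|n IH]; first by rewrite !big_ord0.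
by rewrite !big_ord_recr /= IH.
Qed.

(** The symbol [qpoch] over any coefficient ring: [kser1_sum] needs coefficients in [{poly int}]. *)
Definition qp a n := \prod_(j < n) (1 - a * X ^+ j).

Lemma qp0 a : qp a 0 = 1.
Proof. exact: big_ord0. Qed.

Lemma qpSr a n : qp a n.+1 = qp a n * (1 - a * X ^+ n).
Proof. exact: big_ord_recr. Qed.

Lemma qpSl a n : qp a n.+1 = (1 - a) * qp (a * X) n.
Proof.
rewrite /qp big_ord_recl expr0 mulr1; congr (_ * _).
by apply: eq_bigr => i _; rewrite -mulrA -exprS.
Qed.

Lemma eqmodX_qp N n a b : eqmodX N a b -> eqmodX N (qp a n) (qp b n).
Proof.
move=> ab; apply: (@eqmodX_prod N n (fun j => 1 - a * X ^+ j)
  (fun j => 1 - b * X ^+ j)) => i.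
by apply: eqmodXB => //; apply: eqmodXM.
Qed.

Definition qinf a : fps R := Fps (fun m => fpscoef (qp a m.+1) m).

(** The factor 1 - a X^M is 1 modulo X^M, so coefficient m no longer changes from [qp a m.+1] on. *)
Lemma eqmodX_qinf_qp N M a : (N <= M)%N -> eqmodX N (qinf a) (qp a M).
Proof.
move=> NM m mN; have {NM mN} : (m < M)%N by exact: leq_trans NM.
elim: M => // M IH; rewrite leq_eqVlt => /predU1P[[<-]//|].
rewrite ltnS => mM; rewrite IH // qpSr mulrBr mulr1 fpscoefD fpscoefN mulrA.
by rewrite [X in _ - fpscoef X _]mulrC fpscoefXnM mM subr0.
Qed.

Lemma eqmodX_qinf N a b : eqmodX N a b -> eqmodX N (qinf a) (qinf b).
Proof.
move=> ab; apply: (eqmodX_trans (eqmodX_qinf_qp _ (leqnn N)) _).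
apply: (eqmodX_trans _ (eqmodX_sym (eqmodX_qinf_qp _ (leqnn N)))).
exact: eqmodX_qp.
Qed.

Lemma qinfS a : qinf a = (1 - a) * qinf (a * X).
Proof.
apply: eqmodX_eq => N; apply: (eqmodX_trans (eqmodX_qinf_qp _ (leqnSn N)) _).
by rewrite qpSl; apply/eqmodXM/eqmodX_sym/eqmodX_qinf_qp.
Qed.

Lemma qinfXn a n : qinf (a * X ^+ n) = (1 - a * X ^+ n) * qinf (a * X ^+ n.+1).
Proof. by rewrite qinfS -mulrA -exprSr. Qed.

Lemma qinfX n : qinf (X ^+ n) = (1 - X ^+ n) * qinf (X ^+ n.+1).
Proof. by rewrite qinfS -exprSr. Qed.

Lemma qinf1 : qinf 1 = 0.
Proof. by rewrite qinfS subrr mul0r. Qed.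

Lemma qinf0 : qinf 0 = 1.
Proof.
apply: eqmodX_eq => N; apply: (eqmodX_trans (eqmodX_qinf_qp _ (leqnn N)) _).
by rewrite /qp big1 // => i _; rewrite mul0r subr0.
Qed.

(* The series [\sum_n X^n f n]; the factor X^n makes any family summable. *)
Definition qser f : fps R :=
  Fps (fun m => \sum_(n < m.+1) fpscoef (X ^+ n * f n) m).

Lemma fpscoef_qser f m :
  fpscoef (qser f) m = \sum_(n < m.+1) fpscoef (X ^+ n * f n) m.
Proof. by []. Qed.

Lemma eqmodX_qser_sum f N M :
  (N <= M)%N -> eqmodX N (qser f) (\sum_(n < M) X ^+ n * f n).
Proof.
move=> NM m mN; rewrite (coef_sum M (fun n => X ^+ n * f n)) fpscoef_qser.
have {NM mN} : (m < M)%N by exact: leq_trans NM.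
elim: M => // M IH; rewrite leq_eqVlt => /predU1P[[<-]//|].
by rewrite ltnS => mM; rewrite IH // big_ord_recr fpscoefXnM mM /= addr0.
Qed.

Lemma eqmodX_qser N f g :
  (forall n, eqmodX N (f n) (g n)) -> eqmodX N (qser f) (qser g).
Proof.
move=> fg; apply: (eqmodX_trans (eqmodX_qser_sum _ (leqnn N)) _).
apply: (eqmodX_trans _ (eqmodX_sym (eqmodX_qser_sum _ (leqnn N)))).
apply: (@eqmodX_sum N N (fun n => X ^+ n * f n) (fun n => X ^+ n * g n)) => n.
exact: eqmodXM.
Qed.

Lemma eq_qser f g : f =1 g -> qser f = qser g.
Proof. by move=> /funext ->. Qed.

Lemma qserD f g : qser f + qser g = qser (fun n => f n + g n).
Proof.
apply/fpsP => m; rewrite fpscoefD !fpscoef_qser -big_split.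
by apply: eq_bigr => i _; rewrite mulrDr fpscoefD.
Qed.

Lemma qserZ c f : c * qser f = qser (fun n => c * f n).
Proof.
apply: eqmodX_eq => N.
apply: (eqmodX_trans _ (eqmodX_sym (eqmodX_qser_sum _ (leqnn N)))).
have fN := eqmodX_qser_sum f (leqnn N).
apply: (eqmodX_trans (eqmodXM (@eqmodX_refl N c) fN) _).
by rewrite mulr_sumr; under eq_bigr do rewrite mulrCA.
Qed.

Lemma qserN f : - qser f = qser (fun n => - f n).
Proof. by rewrite -mulN1r qserZ; apply: eq_qser => n; rewrite mulN1r. Qed.

Lemma qser_recl f : qser f = f 0 + X * qser (fun n => f n.+1).
Proof.
apply: eqmodX_eq => N; apply: (eqmodX_trans (eqmodX_qser_sum _ (leqnSn N)) _).
rewrite big_ord_recl expr0 mul1r; apply: eqmodXD => //.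
under eq_bigr do rewrite /= exprS -mulrA.
rewrite -mulr_sumr; apply: eqmodXM => //.
exact: (eqmodX_sym (eqmodX_qser_sum _ (leqnn N))).
Qed.

Lemma qser_telescope f (U : nat -> fps R) F :
    (forall n, X ^+ n * f n = U n.+1 - U n) ->
    (forall N, eqmodX N (U N) F) ->
  qser f = F - U 0.
Proof.
move=> fU UF; apply: eqmodX_eq => N.
apply: (eqmodX_trans (eqmodX_qser_sum _ (leqnn N)) _).
under eq_bigr do rewrite fU.
rewrite -(big_mkord xpredT (fun i => U i.+1 - U i)) telescope_sumr //.
exact: eqmodXB.
Qed.

(* [E a = E (a X^n)], which tends to [E 0]. *)
Lemma shift_invariant_const (E : fps R -> fps R) a :
    (forall N b c, eqmodX N b c -> eqmodX N (E b) (E c)) ->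
    (forall n, E (a * X ^+ n) = E (a * X ^+ n.+1)) ->
  E a = E 0.
Proof.
move=> Econt Eshift; apply: eqmodX_eq => N.
have -> : E a = E (a * X ^+ N).
  by elim: N => [|N ->]; rewrite ?expr0 ?mulr1.
by apply: Econt; rewrite mulrC; apply: eqmodX_Xn.
Qed.

(** Unfolding the recurrence N times shows that X^N divides [D 0], for every N. *)
Lemma shift_divisible_eq0 (D : nat -> fps R) (c : nat -> fps R) :
  (forall n, D n = X * c n * D n.+1) -> D 0 = 0.
Proof.
move=> DS; apply: eqmodX_eq => N.
have [F ->] : exists F, D 0 = X ^+ N * F; last exact: eqmodX_Xn.
have: exists F, D 0 = X ^+ N * F * D N.
  elim: N => [|N [F ->]]; first by exists 1; rewrite expr0 !mul1r.
  by exists (F * c N); rewrite DS exprSr; ring.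
by case=> F ->; exists (F * D N); rewrite mulrA.
Qed.

End FormalSeries.

(** * Partial theta functions and the identities of Warnaar and of Andrews and Warnaar *)

Section PartialTheta.
Variable R : comNzRingType.
Implicit Types (a b c z : fps R).
Local Notation X := (@fpsX R).

Lemma mulX_Xn a n : a * X * X ^+ n = a * X ^+ n.+1.
Proof. by rewrite -mulrA -exprS. Qed.

(* The partial theta function [\sum_n (-a)^n X^(n(n-1)/2)], by [ptheta_sum]. *)
Definition ptheta a := qser (fun n => qinf (X ^+ n.+1) * qinf (a * X ^+ n)).

Lemma eqmodX_ptheta N a b : eqmodX N a b -> eqmodX N (ptheta a) (ptheta b).
Proof.
by move=> ab; apply: eqmodX_qser => n; apply/eqmodXM/eqmodX_qinf/eqmodXM.
Qed.

(** At a = 0 the series telescopes, as X^n (X^(n+1))_oo = (X^(n+1))_oo - (X^n)_oo, from (1)_oo = 0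
    to the limit 1. *)
Lemma ptheta0 : ptheta 0 = 1.
Proof.
rewrite /ptheta (@qser_telescope _ _ (fun n => qinf (X ^+ n)) 1).
- by rewrite qinf1 subr0.
- by move=> n; rewrite mul0r qinf0 (qinfX _ n); ring.
move=> N; rewrite -[X in eqmodX _ _ X](@qinf0 R); apply: eqmodX_qinf.
by rewrite -[_ ^+ _]mulr1; apply: eqmodX_Xn.
Qed.

Lemma pthetaS a : ptheta a = 1 - a * ptheta (a * X).
Proof.
(* Since [E 0 = 1], it is enough that [E b = E (b * X)]; the difference of these two series
   telescopes. *)
pose E b := ptheta b + b * ptheta (b * X).
suff -> : 1 = E a by rewrite /E; ring.
rewrite -[LHS]ptheta0 (@shift_invariant_const _ E a).
- by rewrite /E !mul0r addr0.
- move=> N b c bc; apply: eqmodXD; first exact: eqmodX_ptheta.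
  by apply: eqmodXM => //; apply/eqmodX_ptheta/eqmodXM.
move=> m; set b := a * X ^+ m; rewrite exprSr mulrA -/b.
apply/eqP; rewrite -subr_eq0; apply/eqP.
rewrite /E /ptheta !qserZ !qserD qserN qserD.
rewrite (@qser_telescope _ _
  (fun n => - b * X ^+ n * qinf (X ^+ n) * qinf (b * X ^+ n.+1)) 0).
- by rewrite expr0 qinf1; ring.
- move=> n; rewrite !mulX_Xn (qinfX _ n) (qinfXn b n) (qinfXn b n.+1) !exprS.
  by ring.
move=> N; rewrite -!mulrA mulrCA; exact: eqmodX_Xn.
Qed.

Lemma ptheta_sum N a : eqmodX N (ptheta (a * X))
  (\sum_(n < N) (- a) ^+ n * X ^+ 'C(n.+1, 2)).
Proof.
(* [pthetaS] applied N times; the remainder vanishes modulo X^N because ['C(N.+1, 2)] is at least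
   N. *)
have -> : ptheta (a * X) = \sum_(n < N) (- a) ^+ n * X ^+ 'C(n.+1, 2) +
    (- a) ^+ N * X ^+ 'C(N.+1, 2) * ptheta (a * X ^+ N.+1).
  elim: N => [|N IH]; first
    by rewrite big_ord0 bin_small // !expr0 expr1 !mul1r add0r.
  rewrite IH big_ord_recr /= (pthetaS (a * X ^+ N.+1)) -(mulrA a _ X) -exprSr.
  by rewrite (binS N.+1) bin1 exprD (exprSr (- a)); ring.
rewrite -[X in eqmodX _ _ X]addr0; apply: eqmodXD => //.
rewrite mulrAC mulrC; apply: eqmodX_Xn.
by rewrite binS bin1 leq_addl.
Qed.

(* [(1 - r) (r X^(n+1))_(n-1)] with [r = a * c]; for n = 0 this reads
   [(r X)_(-1) = 1 / (1 - r)]. *)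
Definition wfac a c n :=
  if n is m.+1 then (1 - a * c) * qp (a * c * X ^+ m.+2) m else 1.

Definition wterm a c n :=
  wfac a c n * (qinf (X ^+ n.+1) * qinf (a * X ^+ n) * qinf (c * X ^+ n.+1)).

(** This is W(a, b) for b = c X, a choice that turns a b / X into [a * c] and so avoids negative
    powers of X. *)
Definition wser a c := qser (wterm a c).

Lemma eqmodX_wser N a b c d :
  eqmodX N a b -> eqmodX N c d -> eqmodX N (wser a c) (wser b d).
Proof.
move=> ab cd; apply: eqmodX_qser => n; rewrite /wterm.
do !apply: eqmodXM => //; try by apply/eqmodX_qinf/eqmodXM.
case: n => //= n; apply: eqmodXM; first by apply/eqmodXB/eqmodXM.
by apply/eqmodX_qp/eqmodXM => //; apply: eqmodXM.
Qed.

(* With [r = a * c], the summand is the difference [Y (n+1) - Y n] for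
     Y n = - r X^n (X - 1 + (r X - 1) X^n) (r X^(n+2))_(n-2)
             (X^n)_oo (a X^n)_oo (c X^(n+1))_oo,
   where [(r X^3)_(-1) = 1 / (1 - r X^2)] and [Y 0 = 0] as [(1)_oo = 0]. *)
Lemma wser_square a c :
  wser a c - wser (a * X) c - wser a (c * X) + wser (a * X) (c * X) = 0.
Proof.
pose Y n := match n with
  | 0 => 0
  | 1 => qinf X * qinf (a * X) * qinf (c * X ^+ 2) * (a * c * X)
  | m.+2 => qinf (X ^+ m.+2) * qinf (a * X ^+ m.+2) * qinf (c * X ^+ m.+3) *
      (qp (a * c * X ^+ m.+4) m *
        (- (a * c) * X ^+ m.+2 * (X - 1 + (a * c * X - 1) * X ^+ m.+2)))
  end.
rewrite /wser !qserN !qserD (@qser_telescope _ _ Y 0) ?subr0 // => [n|N].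
  rewrite /wterm !mulX_Xn.
  rewrite (qinfXn a n) (qinfXn c n.+1).
  have -> : wfac (a * X) (c * X) n = if n is m.+1 then
     (1 - a * c * X ^+ 2) * qp (a * c * X ^+ m.+4) m else 1.
    case: n => //= n; congr ((1 - _) * qp _ _); first by ring.
    by rewrite !exprS; ring.
  have -> : wfac (a * X) c n = if n is m.+1 then
     (1 - a * c * X) * qp (a * c * X ^+ m.+3) m else 1.
    case: n => //= n; congr ((1 - _) * qp _ _); first by ring.
    by rewrite !exprS; ring.
  have -> : wfac a (c * X) n = if n is m.+1 then
     (1 - a * c * X) * qp (a * c * X ^+ m.+3) m else 1.
    case: n => //= n; congr ((1 - _) * qp _ _); first by ring.
    by rewrite !exprS; ring.
  (* From n = k + 3 on, all finite products reduce to the common factor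
     [qp (a * c * X ^+ k.+4.+2) k]; the smaller n are computed directly. *)
  case: n => [|[|[|k]]] /=.
  - by rewrite !expr1; ring.
  - rewrite !qp0 -[X in qinf X]expr1 (qinfX _ 1) (qinfXn a 1) (qinfXn c 2).
    by ring.
  - by rewrite (qinfX _ 2) (qinfXn a 2) (qinfXn c 3) !qpSr !qp0; ring.
  rewrite (qinfX _ k.+3) (qinfXn a k.+3) (qinfXn c k.+4).
  have qpX b j m :
      qp (b * X ^+ j) m.+1 = (1 - b * X ^+ j) * qp (b * X ^+ j.+1) m.
    by rewrite qpSl -mulrA -exprSr.
  rewrite (qpX _ k.+4) !(qpX _ k.+4.+1) !qpSr !(exprS X).
  by ring.
rewrite /Y; case: N => [|[|N]] //.
- set P := _ * qinf (c * X ^+ 2).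
  have -> : P * (a * c * X) = X ^+ 1 * (P * a * c) by ring.
  exact: eqmodX_Xn.
set P := _ * qinf (c * _); set Q := qp _ _; set T := X - 1 + _.
have -> : P * (Q * (- (a * c) * X ^+ N.+2 * T)) =
    X ^+ N.+2 * (- (a * c) * P * Q * T) by ring.
exact: eqmodX_Xn.
Qed.

Lemma wser0 a : wser a 0 = ptheta a.
Proof.
apply: eq_qser => n; rewrite /wterm !mul0r qinf0 mulr1.
case: n => [|n] /=; first by rewrite mul1r.
rewrite mulr0 mul0r subr0 /qp big1 ?mul1r // => i _.
by rewrite mul0r subr0.
Qed.

Lemma wserC0 c : wser 0 c = ptheta (c * X).
Proof.
apply: eq_qser => n; rewrite /wterm !mul0r qinf0 mulr1 mulX_Xn.
case: n => [|n] /=; first by rewrite mul1r.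
rewrite !mul0r subr0 /qp big1 ?mul1r // => i _.
by rewrite mul0r subr0.
Qed.

Lemma wserE a c : wser a c = ptheta a + ptheta (c * X) - 1.
Proof.
(* [wser_square] makes the difference in b invariant under c -> c X, so c can be sent to 0. *)
have Wc b : wser b c - wser (b * X) c = wser b 0 - wser (b * X) 0.
  apply: (@shift_invariant_const _ (fun d => wser b d - wser (b * X) d)).
    by move=> N d e de; apply: eqmodXB; apply: eqmodX_wser.
  move=> n; have := wser_square b (c * X ^+ n).
  rewrite -!(mulrA c) -!exprSr => /eqP.
  by rewrite -addrA addr_eq0 opprD opprK => /eqP.
(* Regrouped, [Wc] is an invariance under b -> b X, so b can be sent to 0 in turn. *)
have := @shift_invariant_const _ (fun b => wser b c - wser b 0) a.
rewrite !wserC0 !wser0 mul0r ptheta0 => H.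
rewrite -[wser a c](subrK (ptheta a)) H; first by ring.
  move=> N d e de; apply: eqmodXB; first exact: eqmodX_wser.
  by rewrite !wser0; apply: eqmodX_ptheta.
move=> n /=; have := Wc (a * X ^+ n); rewrite -(mulrA a) -exprSr.
have swap (x y u v : fps R) : x - y = u - v -> x - u = y - v.
  by move/eqP; rewrite subr_eq => /eqP ->; ring.
exact: swap.
Qed.

Definition fterm a c n := qp (a * c * X ^+ n) n *
  (qinf (X ^+ n.+1) * qinf (a * X ^+ n) * qinf (c * X ^+ n.+1)).

Definition fser a c := qser (fterm a c).

(** The terms of index 0 agree. At index n + 1, with r = [a * c], the finite products differ by the
    factor (1 - r X^(n+1)) - (1 - r) = r (1 - X^(n+1)), and 1 - X^(n+1) turns (X^(n+2))_oo into
    (X^(n+1))_oo. *)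
Lemma fserS a c : fser a c = wser a c + X * (a * c) * fser (a * X) (c * X).
Proof.
rewrite /fser /wser -mulrA qserZ.
rewrite (qser_recl (fterm a c)) (qser_recl (wterm a c)).
rewrite -addrA -mulrDr qserD; congr (_ + X * _).
  by rewrite /fterm qp0.
apply: eq_qser => n; rewrite /fterm /wterm !mulX_Xn /=.
rewrite [in LHS]qpSl -(mulrA (a * c)) -exprSr.
have -> : a * X * (c * X) * X ^+ n = a * c * X ^+ n.+2 by rewrite !exprS; ring.
rewrite (qinfX _ n.+1).
move: (qp _ n) (qinf (X ^+ _)) (qinf (a * _)) (qinf (c * _)) => P Q1 Q2 Q3.
by ring.
Qed.

(* The difference of the two sides at (a, c) is [X * (a * c)] times that at
   (a X, c X), hence divisible by every power of X. *)
Lemma fserE a c : fser a c = ptheta a * ptheta (c * X).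
Proof.
apply/eqP; rewrite -subr_eq0; apply/eqP.
pose D n := fser (a * X ^+ n) (c * X ^+ n) -
  ptheta (a * X ^+ n) * ptheta (c * X ^+ n * X).
have := @shift_divisible_eq0 _ D (fun n => a * X ^+ n * (c * X ^+ n)).
rewrite /D expr0 !mulr1; apply=> n.
rewrite fserS wserE -!(mulrA a) -!(mulrA c) -!exprSr.
rewrite (pthetaS (a * X ^+ n)) (pthetaS (c * X ^+ n.+1)).
rewrite -!(mulrA a) -!(mulrA c) -!exprSr.
by rewrite (exprS _ n); ring.
Qed.

(** The summand of W(z, X) / (1 - z) with the division carried out, so that z = 1 is allowed. *)
Definition kterm z n := qp (z * X ^+ n) n *
  (qinf (X ^+ n.+1) ^+ 2 * qinf (z * X ^+ n.+1)).

Definition kser z := qser (kterm z).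

Lemma kser_wser z : (1 - z) * kser z = wser z 1.
Proof.
rewrite qserZ; apply: eq_qser => -[|n]; rewrite /kterm /wterm /=.
  by rewrite qp0 mulr1 !mul1r (qinfS z) expr1; ring.
rewrite qpSl -(mulrA z) -exprSr (qinfXn z n.+1) !mul1r mulr1.
by ring.
Qed.

(** As p(z) = 1 - z p(z X), the left side is p(X) - z p(z X); its n-th terms combine into the factor
    1 - z^(n+1), a geometric sum. *)
Lemma kser_sum N z : eqmodX N ((1 - z) * kser z)
  ((1 - z) * \sum_(n < N) (-1) ^+ n * X ^+ 'C(n.+1, 2) *
     \sum_(l < n.+1) z ^+ l).
Proof.
rewrite kser_wser wserE (pthetaS z).
have -> : 1 - z * ptheta (z * X) + ptheta (1 * X) - 1 =
  ptheta (1 * X) - z * ptheta (z * X) by ring.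
have -> : (1 - z) * \sum_(n < N) (-1) ^+ n * X ^+ 'C(n.+1, 2) *
      \sum_(l < n.+1) z ^+ l =
    \sum_(n < N) (-1) ^+ n * X ^+ 'C(n.+1, 2) -
    z * \sum_(n < N) (- z) ^+ n * X ^+ 'C(n.+1, 2).
  rewrite [LHS]mulr_sumr [X in _ = _ - X]mulr_sumr -sumrB.
  apply: eq_bigr => n _.
  have geom : (1 - z) * (\sum_(l < n.+1) z ^+ l) = 1 - z * z ^+ n.
    by rewrite -exprS -opprB mulNr -subrX1 opprB.
  by rewrite mulrCA geom (exprNn z); ring.
by apply: eqmodXB; [|apply: eqmodXM => //]; apply: ptheta_sum.
Qed.
End PartialTheta.

(** * Constant series and change of coefficient ring, for the evaluation at z = 1 *)

Section ConstantSeries.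
Variable R : comNzRingType.
Implicit Types F G : fps R.

Definition fpsC (c : R) : fps R := Fps (fun m => if m is 0 then c else 0).

Lemma fpscoefCM (c : R) F m : fpscoef (fpsC c * F) m = c * fpscoef F m.
Proof.
rewrite fpscoefM big_ord_recl /= subn0 big1 ?addr0 // => i _.
by rewrite mul0r.
Qed.

Lemma fpsC1 : fpsC 1 = 1.
Proof. by apply/fpsP; case. Qed.

Lemma fpsCB (c d : R) : fpsC (c - d) = fpsC c - fpsC d.
Proof. by apply/fpsP; case=> //= m; rewrite subr0. Qed.

End ConstantSeries.

Lemma eqmodX_mulCI (R : idomainType) N (c : R) (F G : fps R) : c != 0 ->
  eqmodX N (fpsC c * F) (fpsC c * G) -> eqmodX N F G.
Proof.
move=> c0 FG m mN; apply: (mulfI c0); rewrite -!fpscoefCM; exact: FG.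
Qed.

Section MapSeries.
Variables (R S : comNzRingType) (f : {rmorphism R -> S}).
Implicit Types F G : fps R.

Definition fpsmap F : fps S := Fps (fun m => f (fpscoef F m)).

Fact fpsmap_is_zmod_morphism : zmod_morphism fpsmap.
Proof. by move=> F G; apply/fpsP => m; rewrite /= rmorphB. Qed.

Fact fpsmap_is_monoid_morphism : monoid_morphism fpsmap.
Proof.
split; first by apply/fpsP => m; rewrite /= rmorph_nat.
move=> F G; apply/fpsP => m; rewrite /= rmorph_sum.
by apply: eq_bigr => i _; rewrite rmorphM.
Qed.

HB.instance Definition _ :=
  GRing.isZmodMorphism.Build (fps R) (fps S) fpsmap fpsmap_is_zmod_morphism.
HB.instance Definition _ :=
  GRing.isMonoidMorphism.Build (fps R) (fps S) fpsmap fpsmap_is_monoid_morphism.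

Lemma fpsmapX : fpsmap fpsX = fpsX.
Proof. by apply/fpsP => m; rewrite /= rmorph_nat. Qed.

Lemma fpsmapC c : fpsmap (fpsC c) = fpsC (f c).
Proof. by apply/fpsP; case=> //= m; rewrite rmorph0. Qed.

Lemma eqmodX_fpsmap N F G : eqmodX N F G -> eqmodX N (fpsmap F) (fpsmap G).
Proof. by move=> FG m mN /=; rewrite FG. Qed.

Lemma fpsmap_qp a n : fpsmap (qp a n) = qp (fpsmap a) n.
Proof.
rewrite rmorph_prod; apply: eq_bigr => i _.
by rewrite rmorphB rmorph1 rmorphM rmorphXn /= fpsmapX.
Qed.

Lemma fpsmap_qinf a : fpsmap (qinf a) = qinf (fpsmap a).
Proof.
apply/fpsP => m.
exact: (congr1 (fun F : fps S => fpscoef F m) (fpsmap_qp a m.+1)).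
Qed.

Lemma fpsmap_qser g : fpsmap (qser g) = qser (fun n => fpsmap (g n)).
Proof.
apply/fpsP => m; rewrite fpscoef_qser [LHS]/= rmorph_sum.
apply: eq_bigr => i _.
by rewrite -[in RHS]fpsmapX -(rmorphXn fpsmap) -(rmorphM fpsmap).
Qed.

Lemma fpsmap_kser z : fpsmap (kser z) = kser (fpsmap z).
Proof.
rewrite fpsmap_qser; apply: eq_qser => n; rewrite /kterm.
by rewrite !(rmorphM, rmorphXn) /= !(fpsmap_qp, fpsmap_qinf)
           !(rmorphM, rmorphXn) /= fpsmapX.
Qed.

End MapSeries.

(* [1 - z] can be cancelled for an indeterminate z, not for [z = 1]. *)
Lemma kser1_sum N : eqmodX N (kser (1 : fps int))
  (\sum_(n < N) (-1) ^+ n * 'q ^+ 'C(n.+1, 2) * n.+1%:R).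
Proof.
pose z := fpsC ('X : {poly int}).
have z1 : 1 - z = fpsC (1 - 'X) by rewrite fpsCB fpsC1.
have X1 : 1 - 'X != 0 :> {poly int}.
  by rewrite -opprB oppr_eq0 polyXsubC_eq0.
have := @kser_sum _ N z; rewrite z1 => /(eqmodX_mulCI X1).
move/(eqmodX_fpsmap (horner_eval (1 : int))).
have ez : fpsmap (horner_eval (1 : int)) z = 1.
  by rewrite fpsmapC /= /horner_eval hornerX fpsC1.
rewrite fpsmap_kser ez rmorph_sum /=.
under eq_bigr => n _.
  rewrite !rmorphM !rmorphXn rmorphN1 /= fpsmapX rmorph_sum /=.
  under eq_bigr do rewrite rmorphXn /= ez expr1n.
  rewrite sumr_const card_ord.
  over.
by [].
Qed.

(** * Truncation of infinite sums and the substitution q -> q^8 *)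

Lemma fpscoef_fsum (I : choiceType) (A : set I) (f : I -> fps int) m :
  fpscoef (fps_sum A f) m = \sum_(i \in A) fpscoef (f i) m.
Proof. by []. Qed.

Lemma eqmodX_fsum (I : choiceType) (A : set I) (s : seq I)
    (f : I -> fps int) N :
    uniq s -> (forall i, i \in s -> A i) ->
    (forall i, A i -> i \notin s -> eqmodX N (f i) 0) ->
  eqmodX N (fps_sum A f) (\sum_(i <- s) f i).
Proof.
move=> us sA f0 m mN.
have -> : fpscoef (\sum_(i <- s) f i) m = \sum_(i <- s) fpscoef (f i) m.
  by elim: (s) => [|i l IH]; rewrite ?big_nil ?big_cons //= IH.
rewrite fsbig_seq //; apply/esym/fsbig_widen => [i /sA //|i [Ai /negP/f0]].
by apply.
Qed.

(** The operator sending F(q) to q^2 F(q^8). *)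
Definition dilate (F : fps int) : fps int :=
  Fps (fun m => if (m %% 8 == 2)%N then fpscoef F (m %/ 8)%N else 0).

Lemma fpscoef_dilate F m : fpscoef (dilate F) m =
  if (m %% 8 == 2)%N then fpscoef F (m %/ 8)%N else 0.
Proof. by []. Qed.

Lemma dilateB F G : dilate (F - G) = dilate F - dilate G.
Proof. by apply/fpsP => m /=; case: eqP; rewrite ?subr0. Qed.

Lemma dilate2 F : dilate (2 * F) = 2 * dilate F.
Proof.
by rewrite !mulr_natl !mulr2n; apply/fpsP => m /=; case: eqP.
Qed.

Lemma dilate_fsum (I : choiceType) (A : set I) (f : I -> int) (e : I -> nat) :
  dilate (\fsum_(i in A) ((f i)%:~R * 'q ^+ e i)) =
  \fsum_(i in A) ((f i)%:~R * 'q ^+ (8 * e i + 2)).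
Proof.
have monom (c : int) d m :
    fpscoef (c%:~R * 'q ^+ d) m = if m == d then c else 0.
  rewrite mulrC fpscoefXnM fpscoef_int intz; case: ltngtP => [//|lt|->].
    by rewrite subn_eq0 leqNgt lt.
  by rewrite subnn eqxx.
apply/fpsP => m; rewrite fpscoef_fsum fpscoef_dilate fpscoef_fsum.
case: eqP => [m2|m2].
  apply: eq_fsbigr => i _; rewrite !monom; congr (if _ then _ else _).
  by rewrite {2}(divn_eq m 8) m2 eqn_add2r mulnC eqn_pmul2l.
apply/esym/fsbig1 => i _; rewrite monom; case: eqP => // m8.
by case: m2; rewrite m8 mulnC modnMDl.
Qed.

(** * The square of a partial theta function as a sum over pairs *)

(** Counting the pairs r <= s twice covers all ordered pairs, but the diagonal once too often: hence
    the factor 2 and the last series of the theorem. *)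
Lemma sum_le_pairs (R : comNzRingType) (t : nat -> R) N :
  2 * (\sum_(s < N) \sum_(r < s.+1) t r * t s) - \sum_(s < N) t s * t s =
  (\sum_(s < N) t s) * (\sum_(s < N) t s).
Proof.
elim: N => [|N IH]; first by rewrite !big_ord0; ring.
rewrite !(big_ord_recr N) /=.
move: IH; rewrite -mulr_suml.
move: (\sum_(s < N) \sum_(r < s.+1) _) (\sum_(s < N) t s) => P T.
move: (\sum_(s < N) _) (t N) => Q u IH.
transitivity (2 * P - Q + (2 * T * u + u * u)); first by ring.
by rewrite IH; ring.
Qed.

Lemma leq_triangular n : (n <= 'C(n.+1, 2))%N.
Proof. by rewrite binS bin1 leq_addl. Qed.

(** Put s = r + n, so that (-1)^n = (-1)^r (-1)^s. Pairs with s >= N have an exponent of at least N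
    and drop out. *)
Lemma eqmodX_fsum_pairs N :
  eqmodX N
    (\fsum_(rn in [set: nat * nat])
       (((-1) ^+ rn.2)%:~R * 'q ^+ ('C(rn.1.+1, 2) + 'C((rn.1 + rn.2).+1, 2))))
    (\sum_(s < N) \sum_(r < s.+1)
       ((-1) ^+ r * 'q ^+ 'C(r.+1, 2)) * ((-1) ^+ s * 'q ^+ 'C(s.+1, 2))).
Proof.
pose l := [seq (r, s - r)%N | s <- iota 0 N, r <- iota 0 s.+1].
apply: (eqmodX_trans (@eqmodX_fsum _ _ l _ N _ _ _)) => //.
- apply: allpairs_uniq_dep => [|s _|]; rewrite ?iota_uniq //.
  move=> _ _ /allpairsPdep[s [r [_ rs ->]]]
    /allpairsPdep[s' [r' [_ rs' ->]]] /=.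
  move: rs rs'; rewrite !mem_iota /= !ltnS => rs rs' [rr].
  by rewrite -rr in rs' *; move/(congr1 (addn^~ r)); rewrite !subnK // => ->.
- move=> [r n] _ /= /allpairsPdep nl; rewrite mulrC; apply: eqmodX_Xn.
  apply: leq_trans (leq_addl _ _); apply: leq_trans (leq_triangular _).
  rewrite leqNgt; apply/negP => rnN; apply: nl; exists (r + n)%N, r.
  by rewrite !mem_iota /= ltnS leq_addr rnN addKn.
rewrite big_allpairs_dep -[X in iota 0 X]subn0 big_mkord.
rewrite [X in eqmodX _ X](_ : _ = \sum_(s < N) \sum_(r < s.+1)
    ((-1) ^+ r * 'q ^+ 'C(r.+1, 2)) * ((-1) ^+ s * 'q ^+ 'C(s.+1, 2))) //.
apply: eq_bigr => s _; rewrite -[iota 0 s.+1]/(index_iota 0 s.+1) big_mkord.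
apply: eq_bigr => -[r /=]; rewrite ltnS => rs _.
rewrite subnKC // exprD rmorphXn rmorphN1 -(signr_odd _ (s - r)) oddB //.
by rewrite signr_addb !signr_odd; ring.
Qed.

(** * The generating series of D' and the final identity *)

Lemma qpochinfE (a : fps int) : qpochinf a = qinf a.
Proof.
apply: fps_cvg_unique (@qpoch_cvg a) _ => m; exists m.+1 => k mk.
by rewrite (eqmodX_qinf_qp a mk).
Qed.

(** For n >= 1, (q^(n+1))_n - (q^n)_n = q^n (q^n)_n, since the two products share all factors but 1
    - q^(2n) and 1 - q^n. With the weight q^n of [qser] this gives q^(2n); the terms of index 0
    cancel. *)
Lemma D'_series :
  \fsum_(n in [set n | (0 < n)%N])
     ('q ^+ (2 * n) * qpochinf ('q ^+ n.+1) ^+ 3 * qpoch ('q ^+ n) n) =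
  fser 'q 1 - kser (1 : fps int).
Proof.
pose f n := fterm ('q : fps int) 1 n - kterm 1 n.
have f0 : f 0 = 0.
  by rewrite /f /fterm /kterm !qp0 expr0 !mulr1 !mul1r expr1; ring.
have fS m : f m.+1 =
    'q ^+ m.+1 * (qinf ('q ^+ m.+2) ^+ 3 * qp ('q ^+ m.+1) m.+1).
  rewrite /f /fterm /kterm -exprS !mulr1 !mul1r -exprS.
  rewrite qpSr (qpSl ('q ^+ m.+1)) -exprSr.
  by move: (qp _ _) (qinf _) => P Q; rewrite !(exprS 'q); ring.
rewrite /fser /kser qserN qserD.
apply: eqmodX_eq => N.
apply: (eqmodX_trans _ (eqmodX_sym (eqmodX_qser_sum _ (leqnSn N)))).
apply: (eqmodX_trans (@eqmodX_fsum _ _ (iota 1 N) _ N _ _ _)).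
- exact: iota_uniq.
- by move=> i; rewrite mem_iota => /andP[].
- move=> n n0; rewrite mem_iota n0 /= add1n ltnS -ltnNge => /ltnW Nn.
  by rewrite -mulrA; apply: eqmodX_Xn; rewrite (leq_trans Nn) // leq_pmull.
rewrite big_ord_recl -[X in _ * X + _]/(f 0) f0 mulr0 add0r.
rewrite [X in eqmodX _ X](_ : _ = \sum_(i < N) 'q ^+ i.+1 * f i.+1) //.
rewrite (iotaDl 1 0) big_map -[X in iota 0 X]subn0 big_mkord.
apply: eq_bigr => i _; rewrite fS !qpochinfE add1n mul2n -addnn exprD.
rewrite -[qpoch _ _]/(qp _ _).
by rewrite !mulrA.
Qed.

Theorem theorem1p6 (D' : nat -> int)
  (hD' : \fsum_(n in [set n | (0 < n)%N]) ((D' n)%:~R * 'q ^+ n) =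
         \fsum_(n in [set n | (0 < n)%N])
           ('q ^+ (2 * n) * qpochinf ('q ^+ n.+1) ^+ 3 * qpoch ('q ^+ n) n)) :
  \fsum_(n in [set n | (0 < n)%N]) ((D' n)%:~R * 'q ^+ (8 * n + 2)) =
    2 * (\fsum_(rn in [set: nat * nat])
           ((-1) ^+ rn.2 *
             'q ^+ ((2 * rn.1 + 1) ^ 2 + (2 * rn.1 + 1 + 2 * rn.2) ^ 2)))
    - (\fsum_(n in [set: nat])
         ((-1) ^+ n * n.+1%:R * 'q ^+ (1 + (2 * n + 1) ^ 2)))
    - (\fsum_(n in [set: nat]) 'q ^+ (2 * (2 * n + 1) ^ 2)).
Proof.
(* Through this, each exponent on the right is 8 e + 2 with e built from triangular numbers, so the
   right side is a [dilate]. *)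
have sq n : ((2 * n + 1) ^ 2 = 8 * 'C(n.+1, 2) + 1)%N.
  rewrite -[8%N]/(4 * 2)%N -mulnA (mul2n 'C(_, _)) bin2 even_halfK; last first.
    by rewrite oddM /= andNb.
  by rewrite /=; ring.
rewrite -dilate_fsum hD' D'_series.
pose A := \fsum_(rn in [set: nat * nat])
  (((-1) ^+ rn.2)%:~R * 'q ^+ ('C(rn.1.+1, 2) + 'C((rn.1 + rn.2).+1, 2))).
pose B := \fsum_(n in [set: nat])
  (((-1) ^+ n * n.+1%:Z)%:~R * 'q ^+ 'C(n.+1, 2)).
pose C := \fsum_(n in [set: nat]) (1%:~R * 'q ^+ (2 * 'C(n.+1, 2))).
(* Modulo q^N, [fser 'q 1] is the square of the sum of the [t s], equal to [2 * A - C] by pairs, and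
   [kser 1] is [B]. *)
have -> : fser 'q 1 - kser (1 : fps int) = 2 * A - B - C.
  apply: eqmodX_eq => N.
  pose t s : fps int := (-1) ^+ s * 'q ^+ 'C(s.+1, 2).
  have truncate (f : nat -> int) e : (forall n, n <= e n)%N ->
      eqmodX N (\fsum_(n in [set: nat]) ((f n)%:~R * 'q ^+ e n))
               (\sum_(n < N) (f n)%:~R * 'q ^+ e n).
    move=> le_e; rewrite -(big_mkord xpredT (fun n => (f n)%:~R * 'q ^+ e n)).
    apply: eqmodX_fsum; rewrite ?iota_uniq // => n _.
    rewrite mem_index_iota /= -leqNgt => Nn.
    by rewrite mulrC; apply/eqmodX_Xn/(leq_trans Nn).
  have theta : eqmodX N (ptheta 'q) (\sum_(s < N) t s).
    by rewrite -['q]mul1r; apply: ptheta_sum.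
  have eF : eqmodX N (fser 'q 1) ((\sum_(s < N) t s) * (\sum_(s < N) t s)).
    by rewrite fserE mul1r; apply: eqmodXM.
  have eC : eqmodX N C (\sum_(s < N) t s * t s).
    apply: (eqmodX_trans (truncate (fun=> 1) _ _)).
      by move=> n; apply: leq_trans (leq_triangular n) _; rewrite leq_pmull.
    rewrite [X in eqmodX _ X](_ : _ = \sum_(s < N) t s * t s) //.
    apply: eq_bigr => s _; rewrite /t mulrACA -expr2 sqrr_sign mul1r.
    by rewrite mul2n -addnn exprD mul1r.
  have eB : eqmodX N B (kser 1).
    apply: (eqmodX_trans _ (eqmodX_sym (@kser1_sum N))).
    apply: (eqmodX_trans (truncate _ _ leq_triangular)).
    rewrite [X in eqmodX _ X](_ : _ = \sum_(n < N)
      (-1) ^+ n * 'q ^+ 'C(n.+1, 2) * n.+1%:R) //.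
    by apply: eq_bigr => n _; rewrite rmorphM rmorphXn rmorphN1 mulrAC.
  apply: (eqmodX_trans (eqmodXB eF (eqmodX_sym eB))).
  rewrite -sum_le_pairs -addrA [_ - B]addrC addrA.
  do !apply: eqmodXB => //; last exact: eqmodX_sym.
  by apply: eqmodXM => //; apply/eqmodX_sym/eqmodX_fsum_pairs.
rewrite !dilateB dilate2 !dilate_fsum.
congr (2 * _ - _ - _); congr (fps_sum _ _); apply/funext.
- move=> [r n] /=; rewrite rmorphXn rmorphN1; congr (_ * 'q ^+ _).
  rewrite (_ : (2 * r + 1 + 2 * n = 2 * (r + n) + 1)%N); last by ring.
  by rewrite !sq; ring.
- by move=> n; rewrite rmorphM rmorphXn rmorphN1 sq; congr (_ * 'q ^+ _); ring.
by move=> n; rewrite mul1r sq; congr ('q ^+ _); ring.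
Qed.
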